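(* Let $\mathcal{K}$ denote the real line or the unit circle, and let $\alpha<0$. Let $\mu$ be a (non-negative) measure on $\mathcal{K}$ (defined at least on the Borel subsets of $\mathcal{K}$). Let $p_n$ be orthogonal polynomials on $\mathcal{K}$ with respect to $\mu$ (positivity of leading coefficients is not assumed): $$\int_{\mathcal{K}}p_n(z)\overline{p_m(z)}\,d\mu=A_n\delta_{n,m},\qquad A_n>0,\ n,m\in\mathbb{Z}_+,$$ with $p_n(z)=\sum_{j=0}^n\xi_{n,j}z^j$, $\xi_{n,j}\in\mathbb{C}$, $\xi_{n,n}\ne0$, $n\in\mathbb{Z}_+$. Let $$\widehat y_n(2,\alpha;z)=\sum_{j=0}^n\xi_{n,j}\,y_j(2,\alpha;z),\qquad n\in\mathbb{Z}_+.$$ Then the polynomials $\widehat y_n(2,\alpha;z)$ admit the integral representation $$\widehat y_n(2,\alpha;z)=\frac\beta2e^{\beta z}\int_z^{+\infty}p_n(x)e^{-\beta x}\,dx+\frac\beta2e^{-\beta z}\int_{-\infty}^zp_n(x)e^{\beta x}\,dx,\qquad z\in\mathbb{R},\ n\in\mathbb{Z}_+,$$ where $\beta:=\sqrt{-\frac1\alpha}$.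
   Context: $\mathbb{Z}_+$ is the set of non-negative integers; $[a]$ denotes the greatest integer $\le a$. The polynomials $y_n(2,\alpha;z)$ are $$y_n(2,\alpha;z):=z^n+n!\sum_{k=1}^{[n/2]}(-\alpha)^k\frac{z^{n-2k}}{(n-2k)!},\qquad n\in\mathbb{Z}_+.$$ *)

(* Defs.v *)
From HB Require Import structures.
From mathcomp Require Import all_boot all_order all_algebra complex.
From mathcomp Require Import all_classical all_reals all_analysis.

Set Implicit Arguments.
Unset Strict Implicit.
Unset Printing Implicit Defensive.

Import Order.TTheory GRing.Theory Num.Theory numFieldNormedType.Exports.

Local Open Scope classical_set_scope.
Local Open Scope complex_scope.
Local Open Scope ring_scope.

Inductive curve := RealLine | UnitCircle.

(* [R[i]^o] is [R[i]] with the topology of its norm. *)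
Definition curve_set (R : realType) (K : curve) : set R[i]^o :=
  match K with
  | RealLine => [set z | complex.Im z = 0]
  | UnitCircle => [set z | `|z| = 1]
  end.
Arguments curve_set : clear implicits.

Lemma curve_set1 (R : realType) (K : curve) : (1 : R[i]^o) \in curve_set R K.
Proof. by apply/mem_set; case: K => //=; exact: normr1. Qed.

(* The curve as a type, with the topology induced by [R[i]]; the arbitrary
   base point is only there because measurable types are pointed. *)
Definition curve_pt (R : realType) (K : curve) : Type := curve_set R K.

HB.instance Definition _ (R : realType) (K : curve) :=
  Topological.on (curve_pt R K).
HB.instance Definition _ (R : realType) (K : curve) :=
  isPointed.Build (curve_pt R K) (exist _ 1 (curve_set1 R K)).

Definition curve_val (R : realType) (K : curve) (x : curve_pt R K) : R[i] :=
  sval x.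

Section complex_integral.
Context d (T : measurableType d) (R : realType).
Variable mu : {measure set T -> \bar R}.

Definition cintegrable (D : set T) (f : T -> R[i]) : Prop :=
  mu.-integrable D (fun x => (complex.Re (f x))%:E) /\
  mu.-integrable D (fun x => (complex.Im (f x))%:E).

(* A junk value unless [cintegrable D f]. *)
Definition cintegral (D : set T) (f : T -> R[i]) : R[i] :=
  Rintegral mu D (fun x => complex.Re (f x)) +i*
  Rintegral mu D (fun x => complex.Im (f x)).

End complex_integral.

(* y_n(2, alpha; z) *)
Definition ypoly2 (F : numFieldType) (alpha : F) (n : nat) : {poly F} :=
  'X^n + n`!%:R *:
    \sum_(1 <= k < n./2.+1)
       ((- alpha) ^+ k / (n - 2 * k)`!%:R) *: 'X^(n - 2 * k).

(* p_n for the triangular array [xi] of its coefficients *)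
Definition poly_of_coef (F : numFieldType) (xi : nat -> nat -> F) (n : nat) :
  {poly F} := \sum_(j < n.+1) xi n j *: 'X^j.

Definition yhat2 (F : numFieldType) (alpha : F) (xi : nat -> nat -> F)
    (n : nat) : {poly F} :=
  \sum_(j < n.+1) xi n j *: ypoly2 alpha j.

(* Main.v *)
Require Import Defs.
From HB Require Import structures.
From mathcomp Require Import all_boot all_order all_algebra complex.
From mathcomp Require Import all_classical all_reals all_analysis.
From mathcomp Require Import measurable_realfun ring lra.

Set Implicit Arguments.
Unset Strict Implicit.
Unset Printing Implicit Defensive.

Import Order.TTheory GRing.Theory Num.Theory numFieldNormedType.Exports.

Local Open Scope classical_set_scope.
Local Open Scope complex_scope.
Local Open Scope ring_scope.

(** Write D for differentiation. The polynomial y_n(2, alpha; z) is the sum of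
    (- alpha)^k D^(2 k) z^n, that is, (1 + alpha D^2)^-1 applied to z^n, so by
    linearity y := yhat2 alpha xi n solves y + alpha y'' = p_n ([yhat2_ode]).
    With alpha = - beta^-2 this reads y - beta^-2 y'' = p_n, and the claimed
    formula is the resolvent formula for this equation: the bounded Green
    function of 1 - beta^-2 D^2 on the line is
    beta / 2 * exp (- beta |z - x|).

    Both integrals have explicit antiderivatives: if p = y - beta^-2 y'',
    then p(x) e^(- beta x) is the derivative of
    - beta^-2 (y' + beta y)(x) e^(- beta x), which vanishes at +oo. This
    evaluates the integral over [z, +oo[ ([laplace_poly]); substituting
    - x for x evaluates the one over ]-oo, z] ([laplace_polyN]). When
    the two are combined, the y' terms cancel and y(z) remains
    ([representation_poly]).

    Integrability holds because a polynomial is bounded by a multiple of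
    e^(beta |x| / 2) ([horner_le_expR]). The complex statement
    follows by taking real and imaginary parts, which act on the coefficients
    xi only, since alpha, the point z and the exponentials are real
    ([additive_representation]). *)

(** * The polynomials y_n(2, alpha; z) as solutions of a differential equation *)

(** The summand for k + 1 in degree n + 2 is - alpha (n + 2) (n + 1) times the
    summand for k in degree n, as n! / (n - 2 k)! counts the factors that
    differentiating 2 k times brings down. *)
Lemma ypoly2_rec (F : numFieldType) (alpha : F) n :
  ypoly2 alpha n.+2 = 'X^(n.+2) - (alpha * (n.+2 * n.+1)%:R) *: ypoly2 alpha n.
Proof.
rewrite /ypoly2 /= big_nat_recl//= big_add1 /= [in LHS]scalerDr.
rewrite -scaleNr [in RHS]scalerDr; congr (_ + _).
have fact2 : (n.+2)`!%:R = (n.+2 * n.+1)%:R * n`!%:R :> F.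
  by rewrite !factS -natrM mulnA.
congr (_ + _).
  rewrite muln1 !subSS subn0 expr1 scalerA fact2; congr (_ *: _).
  by field; rewrite pnatr_eq0 -lt0n fact_gt0.
rewrite !scalerA fact2 !scaler_sumr big_add1; apply: eq_bigr => k _.
have -> : (n.+2 - 2 * k.+2 = n - 2 * k.+1)%N by rewrite [(2 * k.+2)%N]mulnS.
rewrite !scalerA exprS; congr (_ *: _); ring.
Qed.

(** In [ypoly2_rec] the leading monomial X^(n + 2) contributes
    alpha (n + 2) (n + 1) X^n to alpha D^2; by induction in steps of two, the
    other term contributes the opposite. *)
Lemma ypoly2_ode (F : numFieldType) (alpha : F) n :
  ypoly2 alpha n + alpha *: (ypoly2 alpha n)^`()^`() = 'X^n.
Proof.
have [m le_nm] := ubnP n; elim: m n le_nm => // m IHm [|[|n]] le_nm.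
- by rewrite /ypoly2 big_geq// scaler0 addr0 expr0 !derivC scaler0 addr0.
- rewrite /ypoly2 big_geq// scaler0 addr0 expr1 derivX.
  by rewrite -[1]/(1%:P) derivC scaler0 addr0.
rewrite ypoly2_rec !derivB !derivZ !derivXn /= derivMn derivXn /=.
set c := alpha * _.
rewrite -mulrnA scalerBr addrACA -opprD [in alpha *: (c *: _)]scalerA.
rewrite [alpha * c]mulrC -[(c * alpha) *: _]scalerA.
rewrite -scalerDr IHm; last by rewrite ltnW.
by rewrite -scaler_nat scalerA [(n.+1 * _)%N]mulnC -addrA subrr addr0.
Qed.

Lemma yhat2_ode (F : numFieldType) (alpha : F) (xi : nat -> nat -> F) n :
  yhat2 alpha xi n + alpha *: (yhat2 alpha xi n)^`()^`() = poly_of_coef xi n.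
Proof.
rewrite /yhat2 /poly_of_coef !raddf_sum -big_split /=.
apply: eq_bigr => j _.
by rewrite !derivZ scalerA mulrC -scalerA -scalerDr ypoly2_ode.
Qed.

Lemma ypoly2_real (R : rcfType) (alpha : R) n :
  ypoly2 alpha%:C n = map_poly (real_complex R) (ypoly2 alpha n).
Proof.
rewrite /ypoly2 rmorphD /= map_polyXn map_polyZ rmorph_nat rmorph_sum /=.
congr (_ + _ *: _); apply: eq_bigr => k _.
by rewrite map_polyZ map_polyXn fmorph_div rmorphXn rmorphN rmorph_nat.
Qed.

(** [phi] stands for the real or the imaginary part. *)
Section real_part.
Variables (R : rcfType) (phi : {additive R[i] -> R}).
Hypothesis phiZ : forall c (r : R), phi (c * r%:C) = phi c * r.

Lemma additive_yhat2 (alpha : R) xi n x :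
  phi (yhat2 alpha%:C xi n).[x%:C] =
  (yhat2 alpha (fun n j => phi (xi n j)) n).[x].
Proof.
rewrite /yhat2 !horner_sum raddf_sum; apply: eq_bigr => j _.
by rewrite !hornerZ ypoly2_real horner_map phiZ.
Qed.

Lemma additive_poly_of_coef xi n x :
  phi (poly_of_coef xi n).[x%:C] =
  (poly_of_coef (fun n j => phi (xi n j)) n).[x].
Proof.
rewrite /poly_of_coef !horner_sum raddf_sum; apply: eq_bigr => j _.
by rewrite !hornerZ !hornerXn -rmorphXn phiZ.
Qed.

End real_part.

(** * Integrals over half-lines *)

Section half_line.
Context {R : realType}.
Notation mu := (@lebesgue_measure R).

(** For a nonnegative integrand the convergence of an antiderivative at +oo also
    gives integrability, as the integral is then finite. *)
Lemma ge0_FTC2y (f F : R -> R) (a l : R) :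
  (forall x, a <= x -> 0 <= f x) -> continuous f ->
  (forall x : R, is_derive x 1 F (f x)) -> F x @[x --> +oo] --> l ->
  mu.-integrable `[a, +oo[ (EFin \o f) /\
  \int[mu]_(x in `[a, +oo[) f x = l - F a.
Proof.
move=> f0 cf dF Fl.
have intE : (\int[mu]_(x in `[a, +oo[) (f x)%:E = l%:E - (F a)%:E)%E.
  apply: ge0_continuous_FTC2y => //.
  - exact: continuous_subspaceT.
  - apply: cvg_at_right_filter; apply: differentiable_continuous.
    by apply/derivable1_diffP; have [] := dF a.
  - by move=> x _; rewrite derive1E; apply: derive_val.
split; last by rewrite /Rintegral intE.
apply/integrableP; split.
  apply/measurable_EFinP; apply: measurable_funTS.
  exact: continuous_measurable_fun.
suff -> : (\int[mu]_(x in `[a, +oo[) `|(f x)%:E| = l%:E - (F a)%:E)%E.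
  by rewrite ltry.
rewrite -intE; apply: eq_integral => x /set_mem /=.
by rewrite in_itv /= andbT => /f0 fx0; rewrite ger0_norm.
Qed.

(** An integrand of varying sign is the difference of [f + h] and [h], which are
    both nonnegative and have convergent antiderivatives. *)
Lemma dominated_FTC2y (f F h H : R -> R) (a l m : R) :
  (forall x, a <= x -> `|f x| <= h x) -> continuous f -> continuous h ->
  (forall x : R, is_derive x 1 F (f x)) ->
  (forall x : R, is_derive x 1 H (h x)) ->
  F x @[x --> +oo] --> l -> H x @[x --> +oo] --> m ->
  mu.-integrable `[a, +oo[ (EFin \o f) /\
  \int[mu]_(x in `[a, +oo[) f x = l - F a.
Proof.
move=> fh cf ch dF dH Fl Hm.
have [ih intH] : mu.-integrable `[a, +oo[ (EFin \o h) /\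
    \int[mu]_(x in `[a, +oo[) h x = m - H a.
  apply: ge0_FTC2y => // x /fh; exact/le_trans.
have [ifh intFH] : mu.-integrable `[a, +oo[ (EFin \o (f \+ h)) /\
    \int[mu]_(x in `[a, +oo[) (f \+ h) x = l + m - (F a + H a).
  apply: (@ge0_FTC2y _ (F \+ H)) => //.
  - by move=> x /fh /lerNnormlW /=; rewrite -subr_ge0 opprK addrC.
  - by move=> x; apply: continuousD; [exact: cf|exact: ch].
  - exact: cvgD.
split.
  have : mu.-integrable `[a, +oo[
      (fun x => (EFin \o (f \+ h)%R) x - (EFin \o h) x)%E.
    exact: integrableB.
  by apply: eq_integrable => // x _; rewrite /= -EFinB addrK.
rewrite (_ : f = fun x => (f \+ h) x - h x); last first.
  by apply/funext => x; rewrite /= addrK.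
rewrite RintegralB// intH intFH; ring.
Qed.

(** Reduces a half-line on the left to one on the right. The change of variables
    x := - x is applied to the nonnegative functions |f| and f + |f|, where
    f = (f + |f|) - |f|. *)
Lemma integral_reflect (f : R -> R) z : continuous f ->
  mu.-integrable `[- z, +oo[ (EFin \o (f \o -%R)) ->
  mu.-integrable `]-oo, z] (EFin \o f) /\
  \int[mu]_(x in `]-oo, z]) f x = \int[mu]_(x in `[- z, +oo[) f (- x).
Proof.
move=> cf fi.
have reflect_ge0 (g : R -> R) : continuous g -> (forall x, 0 <= g x) ->
    (\int[mu]_(x in `]-oo, z]) (g x)%:E =
     \int[mu]_(x in `[(- z)%R, +oo[) (g (- x))%:E)%E.
  move=> cg g0; rewrite -[in LHS](opprK z).
  by rewrite ge0_integration_by_substitutionNy//; exact: continuous_subspaceT.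
have cnf : continuous (fun x => `|f x|).
  by move=> x; apply: continuous_comp; [exact: cf|exact: norm_continuous].
have ifoo : mu.-integrable `]-oo, z] (EFin \o f).
  apply/integrableP; split.
    apply/measurable_EFinP; apply: measurable_funTS.
    exact: continuous_measurable_fun.
  rewrite [ltLHS](reflect_ge0 (fun x => `|f x|))//.
  by have /integrableP[] := fi.
have sumE (D : set R) (g : R -> R) : measurable D ->
    mu.-integrable D (EFin \o g) ->
    \int[mu]_(x in D) g x =
    \int[mu]_(x in D) (g x + `|g x|) - \int[mu]_(x in D) `|g x|.
  move=> mD ig; have ing : mu.-integrable D (EFin \o (fun x => `|g x|)).
    exact: integrable_abse ig.
  by rewrite RintegralD// addrK.
split => //; rewrite (sumE _ f)// (sumE _ (f \o -%R))// /Rintegral.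
rewrite (reflect_ge0 (fun x => `|f x|))//.
rewrite (reflect_ge0 (fun x => f x + `|f x|))// => x.
  exact: (cvgD (cf x) (cnf x)).
by rewrite addrC -lerBlDr sub0r -normrN ler_norm.
Qed.

End half_line.

(** * Laplace transforms of polynomials *)

Section laplace.
Context {R : realType}.
Notation mu := (@lebesgue_measure R).

(** By Horner induction: half of the exponent absorbs the bound on [p], the
    other half the extra factor x, through t <= e^t. Hence the quantification
    over all rates [gamma]. *)
Lemma horner_le_expR (p : {poly R}) (gamma : R) : 0 < gamma ->
  exists2 C, 0 <= C & forall x, `|p.[x]| <= C * expR (gamma * `|x|).
Proof.
elim/poly_ind: p gamma => [|p c IHp] gamma gamma0.
  by exists 0 => // x; rewrite horner0 normr0 mul0r.
have [C C0 pC] := IHp (gamma / 2) ltac:(lra).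
exists (C * (2 / gamma) + `|c|) => [|x].
  by rewrite addr_ge0// mulr_ge0// divr_ge0// ltW.
rewrite hornerMXaddC (le_trans (ler_normD _ _))// mulrDl lerD//.
  have xE : `|x| <= 2 / gamma * expR (gamma / 2 * `|x|).
    rewrite -ler_pdivrMl ?divr_gt0// invf_div.
    by rewrite (le_trans _ (expR_ge1Dx _))// lerDr.
  rewrite normrM (le_trans (ler_pM _ _ (pC x) xE))//.
  have -> : gamma * `|x| = gamma / 2 * `|x| + gamma / 2 * `|x| by field.
  rewrite expRD le_eqVlt; apply/orP; left; apply/eqP; ring.
by rewrite ler_peMr// -expR0 ler_expR mulr_ge0// ltW.
Qed.

Lemma cvg_expRM (beta : R) : 0 < beta ->
  expR (- (beta * x)) @[x --> +oo] --> (0 : R).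
Proof.
move=> beta0.
apply: (@cvg_comp _ _ _ (fun x => beta * x) (fun y => expR (- y)) _ +oo).
  under eq_fun do rewrite mulrC.
  exact: (@gt0_cvgMly R _ _ beta id beta0 cvg_id).
exact: cvgr_expR.
Qed.

(** Half of the decay of e^(- beta x) pays for [p], the other half remains to
    make the bound integrable. The constant depends on [a], which may be negative: |x| is only bounded by
    x + 2 |a| for x >= a. *)
Lemma poly_expR_bound (p : {poly R}) (beta a : R) : 0 < beta ->
  exists C, forall x, a <= x ->
    `|p.[x] * expR (- (beta * x))| <= C * expR (- (beta / 2 * x)).
Proof.
move=> beta0; have [C C0 pC] := @horner_le_expR p (beta / 2) ltac:(lra).
exists (C * expR (beta * `|a|)) => x ax.
rewrite normrM (ger0_norm (expR_ge0 _)).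
rewrite (le_trans (ler_wpM2r (expR_ge0 _) (pC x)))//.
rewrite -!mulrA -!expRD ler_wpM2l// ler_expR.
have : `|x| <= x + 2 * `|a|.
  by have := ler_norm a; have := ler_norm (- a); rewrite normrN;
    case: (ler0P x); lra.
move=> /(ler_wpM2l (ltW beta0)); nra.
Qed.

Lemma cvg_poly_expR (p : {poly R}) (beta : R) : 0 < beta ->
  p.[x] * expR (- (beta * x)) @[x --> +oo] --> (0 : R).
Proof.
move=> beta0; have [C pC] := @poly_expR_bound p beta 0 beta0.
have Clim : C * expR (- (beta / 2 * x)) @[x --> +oo] --> (0 : R).
  by rewrite -(mulr0 C); apply: cvgMr; apply: cvg_expRM; lra.
apply/norm_cvg0P.
apply: (@squeeze_cvgr _ _ _ _ (fun=> 0)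
  (fun x => C * expR (- (beta / 2 * x)))) => //; last exact: cvg_cst.
near=> x; rewrite normr_ge0 /=; apply: pC; near: x.
exact: nbhs_pinfty_ge.
Unshelve. all: by end_near. Qed.

Lemma continuous_poly_expR (p : {poly R}) (b : R) :
  continuous (fun x => p.[x] * expR (b * x)).
Proof.
move=> x; apply: continuousM; first exact: continuous_horner.
by apply: continuous_comp; [exact: mulrl_continuous|exact: continuous_expR].
Qed.

(** With q := - beta^-2 (y' + beta y), the derivative of q(x) e^(- beta x) is
    - beta^-2 (y'' - beta^2 y)(x) e^(- beta x), since the y' terms cancel;
    this is the integrand. Integrability comes from the exponential bound
    of rate beta / 2 on the integrand. *)
Lemma laplace_poly (y : {poly R}) (beta z : R) : 0 < beta ->
  let p := y - beta ^- 2 *: y^`()^`() in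
  let f := fun x => p.[x] * expR (- (beta * x)) in
  mu.-integrable `[z, +oo[ (EFin \o f) /\
  \int[mu]_(x in `[z, +oo[) f x =
    beta ^- 2 * (y^`().[z] + beta * y.[z]) * expR (- (beta * z)).
Proof.
move=> beta0 p f.
have [C fC] := @poly_expR_bound p beta z beta0.
pose q := - (beta ^- 2 *: (y^`() + beta *: y)).
have beta_neq0 : beta != 0 by rewrite gt_eqF.
have dexp (b x : R) : is_derive x 1 (fun x => expR (- (b * x)))
    (- b * expR (- (b * x))).
  have dl : is_derive x (1 : R) (fun x : R => - (b * x)) (- b).
    by apply: is_derive_eq; rewrite /GRing.scale /= mulr1.
  by apply: is_derive_eq; rewrite /GRing.scale /= mulrC.
have cexp (r : {poly R}) (b : R) :
    continuous (fun x => r.[x] * expR (- (b * x))).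
  by under eq_fun do rewrite -mulNr; exact: continuous_poly_expR.
(* The majorant C e^(- beta x / 2) has the explicit antiderivative
   - 2 C / beta e^(- beta x / 2). *)
have [fi fE] : mu.-integrable `[z, +oo[ (EFin \o f) /\
    \int[mu]_(x in `[z, +oo[) f x = 0 - q.[z] * expR (- (beta * z)).
  apply: (@dominated_FTC2y _ f (fun x => q.[x] * expR (- (beta * x)))
    (fun x => C * expR (- (beta / 2 * x)))
    (fun x => - (2 / beta * C) * expR (- (beta / 2 * x))) z 0 0) => //.
  - exact: cexp.
  - by move=> x; have := cexp C%:P (beta / 2) x; under eq_fun do rewrite hornerC.
  - move=> x.
    have dq := is_derive_poly q x; have de := dexp beta x.
    apply: is_derive_eq; rewrite /f /p /q !(derivN, derivZ, derivD).
    by rewrite !(hornerD, hornerN, hornerZ) /GRing.scale /=; field.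
  - move=> x.
    have de := dexp (beta / 2) x.
    by apply: is_derive_eq; rewrite /GRing.scale /=; field.
  - exact: cvg_poly_expR.
  - rewrite -(mulr0 (- (2 / beta * C))); apply: cvgMr; apply: cvg_expRM; lra.
split => //; rewrite fE sub0r /q !(hornerD, hornerN, hornerZ); ring.
Qed.

End laplace.

(** * The integral representation *)

Section representation.
Context {R : realType}.
Notation mu := (@lebesgue_measure R).

(** The equation p = y - beta^-2 y'' is invariant under x := - x, while y'
    changes sign, so this is [laplace_poly] for y(- x) at - z. *)
Lemma laplace_polyN (y : {poly R}) (beta z : R) : 0 < beta ->
  let p := y - beta ^- 2 *: y^`()^`() in
  let g := fun x => p.[x] * expR (beta * x) in
  mu.-integrable `]-oo, z] (EFin \o g) /\
  \int[mu]_(x in `]-oo, z]) g x =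
    beta ^- 2 * (beta * y.[z] - y^`().[z]) * expR (beta * z).
Proof.
move=> beta0 p g; pose yN := y \Po - 'X.
have dN (q : {poly R}) : (q \Po - 'X)^`() = - (q^`() \Po - 'X).
  by rewrite deriv_comp derivN derivX mulrN1.
have hN (q : {poly R}) x : (q \Po - 'X).[x] = q.[- x].
  by rewrite horner_comp !hornerE.
have [] := @laplace_poly _ yN beta (- z) beta0; cbv zeta.
have -> : (fun x => (yN - beta ^- 2 *: yN^`()^`()).[x] * expR (- (beta * x)))
    = g \o -%R.
  apply/funext => x.
  by rewrite /g /p /yN /= !dN !derivN !dN opprK !hornerD !hornerN !hornerZ !hN mulrN.
have cg : continuous g by exact: continuous_poly_expR.
move=> /(integral_reflect cg)[ig ->] /= ->; split => //.
by rewrite /yN !dN !hornerN !hN !opprK mulrN opprK [- _ + _]addrC.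
Qed.

(** In the sum the contributions of y'(z) are opposite and those of
    y(z) add up to beta / 2 * beta^-2 * 2 beta y(z) = y(z). *)
Lemma representation_poly (y : {poly R}) (alpha z : R) : alpha < 0 ->
  let beta := Num.sqrt (- (1 / alpha)) in
  let p := y + alpha *: y^`()^`() in
  let f := fun x => p.[x] * expR (- (beta * x)) in
  let g := fun x => p.[x] * expR (beta * x) in
  [/\ mu.-integrable `[z, +oo[ (EFin \o f),
      mu.-integrable `]-oo, z] (EFin \o g) &
      y.[z] =
        beta / 2 * expR (beta * z) * \int[mu]_(x in `[z, +oo[) f x +
        beta / 2 * expR (- (beta * z)) * \int[mu]_(x in `]-oo, z]) g x].
Proof.
move=> alpha0 beta p f g.
have beta2_gt0 : 0 < - (1 / alpha) by rewrite oppr_gt0 div1r invr_lt0.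
have beta0 : 0 < beta by rewrite sqrtr_gt0.
have alphaE : alpha = - beta ^- 2.
  by rewrite sqr_sqrtr ?ltW// div1r -invrN opprK invrK.
have pE : p = y - beta ^- 2 *: y^`()^`() by rewrite /p alphaE scaleNr.
have [fi intf] := laplace_poly y z beta0.
have [gi intg] := laplace_polyN y z beta0.
rewrite /f /g pE; split => //; rewrite intf intg expRN.
by field; rewrite gt_eqF//= gt_eqF// expR_gt0.
Qed.

End representation.

(** [phi] maps p_n to the real polynomial with coefficients [phi (xi n j)] and
    yhat2 to the one built from the same coefficients, so the real case
    applies. *)
Lemma additive_representation (R : realType) (phi : {additive R[i] -> R})
    (phiZ : forall c (r : R), phi (c * r%:C) = phi c * r)
    (alpha : R) (alpha0 : alpha < 0) (xi : nat -> nat -> R[i]) n z :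
  let mu := @lebesgue_measure R in
  let beta := Num.sqrt (- (1 / alpha)) in
  let p := poly_of_coef xi n in
  let f := fun x : R => p.[x%:C] * (expR (- (beta * x)))%:C in
  let g := fun x : R => p.[x%:C] * (expR (beta * x))%:C in
  [/\ mu.-integrable `[z, +oo[ (EFin \o (phi \o f)),
      mu.-integrable `]-oo, z] (EFin \o (phi \o g)) &
      phi (yhat2 alpha%:C xi n).[z%:C] =
        beta / 2 * expR (beta * z) * \int[mu]_(x in `[z, +oo[) (phi \o f) x +
        beta / 2 * expR (- (beta * z)) * \int[mu]_(x in `]-oo, z]) (phi \o g) x].
Proof.
move=> mu beta p f g; rewrite additive_yhat2//.
pose q := poly_of_coef (fun n j => phi (xi n j)) n.
have -> : phi \o f = fun x => q.[x] * expR (- (beta * x)).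
  by apply/funext => x; rewrite /= phiZ additive_poly_of_coef.
have -> : phi \o g = fun x => q.[x] * expR (beta * x).
  by apply/funext => x; rewrite /= phiZ additive_poly_of_coef.
by rewrite /q -(yhat2_ode alpha); exact: representation_poly.
Qed.

Theorem corollary3 (R : realType) (K : curve) (alpha : R) (halpha : alpha < 0)
    (S : set (set (curve_pt R K)))
    (hS : sigma_algebra setT S)
    (hBorel : <<s (open : set (set (curve_pt R K))) >> `<=` S)
    (mu : {measure set (g_sigma_algebraType S) -> \bar R})
    (xi : nat -> nat -> R[i])
    (hxi : forall n, xi n n != 0)
    (A : nat -> R) (hA : forall n, 0 < A n)
    (horth : forall n m : nat,
       let f := fun x : g_sigma_algebraType S =>
         (poly_of_coef xi n).[curve_val x] *
         ((poly_of_coef xi m).[curve_val x])^* in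
       cintegrable mu setT f /\
       cintegral mu setT f = (if n == m then A n else 0)%:C) :
  let beta := Num.sqrt (- (1 / alpha)) in
  forall (n : nat) (z : R),
    let p := poly_of_coef xi n in
    let f := fun x : R => p.[x%:C] * (expR (- (beta * x)))%:C in
    let g := fun x : R => p.[x%:C] * (expR (beta * x))%:C in
    [/\ cintegrable lebesgue_measure `[z, +oo[ f,
        cintegrable lebesgue_measure `]-oo, z] g &
        (yhat2 alpha%:C xi n).[z%:C] =
          (beta / 2 * expR (beta * z))%:C *
            cintegral lebesgue_measure `[z, +oo[ f +
          (beta / 2 * expR (- (beta * z)))%:C *
            cintegral lebesgue_measure `]-oo, z] g].
Proof.
move=> beta n z p f g.
have phiRe c (r : R) : complex.Re (c * r%:C) = complex.Re c * r.
  by case: c => a b /=; rewrite mulr0 subr0.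
have phiIm c (r : R) : complex.Im (c * r%:C) = complex.Im c * r.
  by case: c => a b /=; rewrite mulr0 add0r.
have [Refi Regi ReE] := additive_representation phiRe halpha xi n z.
have [Imfi Imgi ImE] := additive_representation phiIm halpha xi n z.
split; [by split|by split|].
apply/eqP; rewrite eq_complex; apply/andP; split; apply/eqP.
  by rewrite ReE /cintegral /= !mul0r !subr0.
by rewrite ImE /cintegral /= !mul0r !addr0.
Qed.
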